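(* Let $n\ge 2$ and let $\mathfrak{sl}_n$ denote the Lie algebra of all trace-zero complex $n\times n$ matrices with bracket $[x,y]=xy-yx$. A linear map $\Delta:\mathfrak{sl}_n\to\mathfrak{sl}_n$ is a local automorphism if and only if there exist an invertible matrix $a\in M_n(\mathbb{C})$ and a sign $\varepsilon\in\{1,-1\}$ such that either $\Delta(x)=\varepsilon\, a x a^{-1}$ for all $x\in\mathfrak{sl}_n$, or $\Delta(x)=\varepsilon\, a x^t a^{-1}$ for all $x\in\mathfrak{sl}_n$. (Here $x^t$ is the transpose of $x$; equivalently, $\Delta$ is a local automorphism iff it is an automorphism or an anti-automorphism of $\mathfrak{sl}_n$.)
   Context: An automorphism of a Lie algebra $\mathcal{L}$ is an invertible linear map $\Phi$ with $\Phi([x,y])=[\Phi(x),\Phi(y)]$ for all $x,y$. A linear map $\Delta:\mathcal{L}\to\mathcal{L}$ is a local automorphism if for every $x\in\mathcal{L}$ there exists an automorphism $\Phi_x$ of $\mathcal{L}$ (depending on $x$) with $\Phi_x(x)=\Delta(x)$. *)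

(* Defs.v *)
From HB Require Import structures.
From mathcomp Require Import all_boot all_order all_algebra.
Set Implicit Arguments. Unset Strict Implicit. Unset Printing Implicit Defensive.
Import Order.TTheory GRing.Theory Num.Theory.
Local Open Scope ring_scope.

Section SL.
Variables (C : numClosedFieldType) (n : nat).

Definition tr0 : {pred 'M[C]_n} := [pred x | \tr x == 0].

Fact tr0_closed : subsemimod_closed tr0.
Proof.
split; [split|].
- by rewrite inE mxtrace0.
- by move=> x y; rewrite !inE mxtraceD => /eqP -> /eqP ->; rewrite addr0.
by move=> a x; rewrite !inE mxtraceZ => /eqP ->; rewrite mulr0.
Qed.
HB.instance Definition _ := GRing.isSubmodClosed.Build C 'M[C]_n tr0 tr0_closed.

Record sl := SL { slval : 'M[C]_n; slvalP : slval \in tr0 }.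
HB.instance Definition _ := [isSub for slval].
HB.instance Definition _ := [Choice of sl by <:].
HB.instance Definition _ := [SubChoice_isSubLmodule of sl by <:].

Fact comm_tr0 (x y : sl) : slval x *m slval y - slval y *m slval x \in tr0.
Proof. by rewrite inE raddfB /= mxtrace_mulC subrr. Qed.

Definition slbr (x y : sl) : sl := SL (comm_tr0 x y).

Definition sl_automorphism (Phi : sl -> sl) : Prop :=
  [/\ linear Phi, bijective Phi &
      forall x y, Phi (slbr x y) = slbr (Phi x) (Phi y)].

Definition sl_local_automorphism (D : sl -> sl) : Prop :=
  linear D /\
  forall x, exists Phi, sl_automorphism Phi /\ Phi x = D x.

End SL.

(* Main.v *)
Require Import Defs.
From HB Require Import structures.
From mathcomp Require Import all_boot all_order all_fingroup all_algebra ring zify.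
Import Order.TTheory GRing.Theory Num.Theory.
Local Open Scope ring_scope.

(* A traceless [x] has rank at most one iff [x,[x,y]] is a multiple of [x] for
   all [y], so a local automorphism preserves the rank-one nilpotents in both
   directions.  Hence the images of the matrix units E_ij (i <> j), up to a
   transposition, are multiples of p_i q_j for a basis (p_i) with dual basis
   proportional to (q_j); after conjugation every E_ij is scaled, and the image
   of the rank-one matrices built from several E_ij and E_ii - E_kk shows that
   the map is t times a conjugation.  The eigenvalues of ad (E_ii - E_kk) give
   t = 1 or t = -1.  Conversely, x |-> a x a^-1 and x |-> - a x^T a^-1 are
   automorphisms, and the other two signs reduce to these because every matrix
   is similar to its transpose. *)

(** * Every complex matrix is similar to its transpose *)

(** Write the characteristic polynomial as [q * 'X^m] with [q.[0] != 0]. The matrix [Q = q(B)] is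
    nonzero and killed by a power of [B]. If [k.+1] is the least such power, a nonzero entry of
    [Q B^k Q] selects the row [v] and the column [f] of [Q]. *)
Lemma nilpotent_chain (F : fieldType) (n : nat) (B : 'M[F]_n.+1) :
  eigenvalue B 0 ->
  exists k (v : 'rV[F]_n.+1) (f : 'cV[F]_n.+1),
    [/\ v *m B ^+ k.+1 = 0, B ^+ k.+1 *m f = 0 &
        (v *m B ^+ k *m f) 0 0 != 0].
Proof.
case/eigenvalueP=> u; rewrite scale0r => uB u0.
case: (multiplicity_XsubC (char_poly B) 0) => m [q].
rewrite monic_neq0 ?char_poly_monic //= subr0 rootE => q0 Bq.
pose Q := horner_mx B q.
have [r qE] : exists r, q = 'X * r + (q.[0])%:P.
  have /factor_theorem [r rE] : root (q - (q.[0])%:P) 0.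
    by rewrite /root !hornerE subrr.
  by exists r; rewrite mulrC -['X]subr0 -[0]/(0%:P) -rE subrK.
have QE : Q = B * horner_mx B r + (q.[0])%:M.
  by rewrite /Q {1}qE rmorphD rmorphM /= horner_mx_X horner_mx_C.
(* On the kernel vector [u] the matrix [Q] acts as the nonzero scalar [q.[0]]. *)
have Q0 : Q != 0.
  apply: contra_neq u0 => Q0.
  have : u *m Q = 0 by rewrite Q0 mulmx0.
  rewrite QE mulmxDr mulmxA uB mul0mx add0r mul_mx_scalar => /eqP.
  by rewrite scaler_eq0 (negPf q0) => /eqP.
have ex : exists k, B ^+ k * Q == 0.
  exists m; rewrite -{1}[B]horner_mx_X -rmorphXn -rmorphM mulrC /= -Bq.
  by rewrite Cayley_Hamilton.
case: (ex_minnP ex) => [[|k]]; first by rewrite mul1r (negPf Q0).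
move=> /eqP BkQ min; have {min} BkQ' : B ^+ k * Q != 0.
  by apply/negP => /min; rewrite ltnn.
have cBQ : GRing.comm B Q by rewrite /GRing.comm; apply: comm_mx_horner.
have QBk : Q * B ^+ k.+1 = 0 by rewrite (commrX _ (commr_sym cBQ)) ?BkQ.
(* Since [Q = B r(B) + q.[0]] and [B^(k+1) Q = 0], this product is [q.[0]] times [B^k Q]. *)
have : Q * B ^+ k * Q != 0.
  rewrite (commrX _ (commr_sym cBQ)) {2}QE mulrDr mulrA -[B ^+ k * Q * B]mulrA.
  rewrite -cBQ mulrA -exprSr BkQ mul0r add0r -mulmxE mul_mx_scalar.
  by rewrite scaler_eq0 negb_or q0.
case/matrix0Pn => i [j ij].
exists k, (row i Q), (col j Q); split.
- by rewrite -row_mul mulmxE QBk row0.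
- by rewrite colE mulmxA mulmxE BkQ mul0mx.
by rewrite -row_mul colE mulmxA -row_mul -colE !mxE mulmxE in ij *.
Qed.

Section HankelChain.
Variables (F : fieldType) (n k : nat) (B : 'M[F]_n).
Variables (v : 'rV[F]_n) (f : 'cV[F]_n).
Hypotheses (vB : v *m B ^+ k.+1 = 0) (Bf : B ^+ k.+1 *m f = 0).
Hypothesis vBf : (v *m B ^+ k *m f) 0 0 != 0.

Let U := \matrix_(i < k.+1) (v *m B ^+ i).
Let W := \matrix_(i < n, j < k.+1) (B ^+ j *m f) i 0.
Let J : 'M[F]_k.+1 := \matrix_(i, j) (j == i.+1 :> nat)%:R.

(** [J] is the nilpotent shift. Its last row is zero, which matches the vanishing of [g k.+1]. *)
Lemma chain_sum (V : lmodType F) (g : nat -> V) (i : 'I_k.+1) :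
  g k.+1 = 0 -> \sum_j J i j *: g j = g i.+1.
Proof.
move=> g0; case: (ltnP i.+1 k.+1) => hi; last first.
  have -> : i.+1 = k.+1 by apply/eqP; rewrite eqn_leq hi ltn_ord.
  rewrite g0 big1 // => j _; rewrite mxE; case: eqP => [jE|_]; last exact: scale0r.
  by move: (ltn_ord j); rewrite jE ltnNge hi.
rewrite (bigD1 (Ordinal hi)) //= mxE eqxx scale1r big1 ?addr0 // => j ji.
by rewrite mxE -(inj_eq val_inj) /= in ji *; rewrite (negPf ji) scale0r.
Qed.

Lemma chain_row : U *m B = J *m U.
Proof.
apply/row_matrixP=> i; rewrite !row_mul rowK [RHS]mulmx_sum_row.
rewrite (eq_bigr (fun j : 'I_k.+1 => J i j *: (v *m B ^+ j))) => [|j _].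
  by rewrite (@chain_sum _ (fun j => v *m B ^+ j)) // exprSr -mulmxE mulmxA.
by rewrite mxE rowK.
Qed.

Lemma chain_col : B *m W = W *m J^T.
Proof.
apply/matrixP=> a i; rewrite [RHS]mxE.
rewrite (eq_bigr (fun j : 'I_k.+1 => J i j *: ((B ^+ j *m f) a 0 : F^o))).
  rewrite (@chain_sum F^o (fun j => (B ^+ j *m f) a 0)); last by rewrite Bf mxE.
  rewrite exprS -mulmxE -mulmxA [in RHS]mxE mxE.
  by apply: eq_bigr => b _; rewrite !mxE.
by move=> j _; rewrite !mxE mulrC.
Qed.

Lemma chain_gram_entry (i j : 'I_k.+1) :
  (U *m W) i j = (v *m B ^+ (i + j) *m f) 0 0.
Proof.
have -> : (U *m W) i j = (row i U *m col j W) 0 0.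
  by rewrite [LHS]mxE [RHS]mxE; apply: eq_bigr => a _; rewrite !mxE.
rewrite rowK.
have -> : col j W = B ^+ j *m f by apply/matrixP=> a b; rewrite !mxE (ord1 b).
by rewrite exprD -mulmxE !mulmxA.
Qed.

(* Reversing the columns of the Hankel matrix makes it triangular. *)
Lemma chain_gram_unit : U *m W \in unitmx.
Proof.
pose s := perm (@rev_ord_inj k.+1).
suff : col_perm s (U *m W) \in unitmx.
  by rewrite col_permE unitmx_mul => /andP[].
rewrite -unitmx_tr unitmxE det_trig.
  rewrite unitfE prodf_seq_neq0; apply/allP => i _ /=.
  rewrite 2!mxE chain_gram_entry permE /=.
  have -> : (i + (k.+1 - i.+1) = k)%N by rewrite subSS subnKC // -ltnS.
  by [].
apply/is_trig_mxP => i j ij; rewrite 2!mxE chain_gram_entry permE /= subSS.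
have -> : (j + (k - i) = k.+1 + (j - i.+1))%N.
  by move: (ltn_ord i); lia.
by rewrite exprD -mulmxE mulmxA vB !mul0mx mxE.
Qed.

(** The three facts yield [J (U W) = U B W = (U W) J^T], so the Gram matrix intertwines the block
    [J] with its transpose. *)
Lemma chain_data :
  exists (U : 'M_(k.+1, n)) (W : 'M_(n, k.+1)) (J : 'M_k.+1),
    [/\ U *m B = J *m U, B *m W = W *m J^T & U *m W \in unitmx].
Proof.
by exists U, W, J; split; [exact: chain_row|exact: chain_col|exact: chain_gram_unit].
Qed.

End HankelChain.

(** Here [A = Q B P], and [Q S Q^T] transports the intertwiner. [P] and [Q] are rectangular because
    the block sum used later has size [k.+1 + m], equal to [n.+1] only propositionally. *)
Lemma tr_similar_conj (F : fieldType) (m n : nat) (A : 'M[F]_n) (B : 'M[F]_m)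
    (P : 'M[F]_(m, n)) (Q : 'M[F]_(n, m)) :
  P *m Q = 1%:M -> Q *m P = 1%:M -> P *m A = B *m P ->
  (exists2 S, S \in unitmx & B *m S = S *m B^T) ->
  exists2 S, S \in unitmx & A *m S = S *m A^T.
Proof.
move=> PQ QP PA [S Su BS]; exists (Q *m S *m Q^T).
  have e : Q *m S *m Q^T *m (P^T *m invmx S *m P) = 1%:M.
    rewrite !mulmxA -[Q *m S *m Q^T *m P^T]mulmxA -trmx_mul PQ trmx1 mulmx1.
    by rewrite mulmxK.
  by case: (mulmx1_unit e).
have AE : A = Q *m B *m P by rewrite -mulmxA -PA mulmxA QP mul1mx.
rewrite {1}AE -!mulmxA [P *m (Q *m _)]mulmxA PQ mul1mx [B *m (S *m _)]mulmxA BS.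
rewrite -!mulmxA; congr (_ *m (_ *m _)).
by rewrite -!trmx_mul AE -!mulmxA PQ mulmx1.
Qed.

(* A singular [B] splits off a nilpotent cyclic block on which the Hankel matrix
   of the [v B^(i+j) f] intertwines the block with its transpose. *)
Lemma trmx_similar (C : numClosedFieldType) (n : nat) (A : 'M[C]_n) :
  exists2 S, S \in unitmx & A *m S = S *m A^T.
Proof.
elim/ltn_ind: n A => -[_ A|n IH A].
  by exists 1%:M; rewrite ?unitmx1 // [LHS]flatmx0 [RHS]flatmx0.
have [a] := eigenvalue_closed A (ltn0Sn n).
set B := A - a%:M => evA.
(* Scalar matrices are symmetric and central, so subtracting an eigenvalue is harmless and makes the
   matrix singular. *)
suff [S Su BS] : exists2 S, S \in unitmx & B *m S = S *m B^T.
  have BT : (B + a%:M)^T = B^T + a%:M by rewrite [LHS]raddfD /= tr_scalar_mx.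
  exists S => //; rewrite -(subrK a%:M A) -/B mulmxDl BS BT mulmxDr.
  by rewrite scalar_mxC.
have evB : eigenvalue B 0.
  case/eigenvalueP: evA => u uA u0; apply/eigenvalueP; exists u => //.
  by rewrite mulmxBr uA mul_mx_scalar subrr scale0r.
have [k [v [f [vB Bf vBf]]]] := @nilpotent_chain _ _ _ evB.
have [U [W [J [UB BW UW]]]] := @chain_data _ _ _ _ _ _ vB Bf vBf.
have rW : \rank W = k.+1.
  apply/eqP; rewrite eqn_leq rank_leq_col /=.
  by rewrite -{1}(mxrank_unit UW) mxrankM_maxr.
(* The left kernel of [W] is stable under [B] because [B W = W J^T]; its basis [K] carries the
   complementary block [B2]. *)
pose m := \rank (kermx W); pose K := row_base (kermx W).
have KW : K *m W = 0 by apply/sub_kermxP; rewrite eq_row_base.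
have [B2 KB] : exists B2, K *m B = B2 *m K.
  apply/submxP; rewrite (eq_row_base (kermx W)); apply/sub_kermxP.
  by rewrite -mulmxA BW mulmxA KW mul0mx.
have kn : (k.+1 + m = n.+1)%N.
  by rewrite /m mxrank_ker rW subnKC // -rW rank_leq_row.
(* Invertibility of [U W] makes the rows of [U] independent modulo the left kernel of [W], and the
   dimensions add up to [n.+1]. *)
pose P := col_mx U K.
have Pfree : row_free P.
  apply: inj_row_free => x; rewrite -[x]hsubmxK mul_row_col => xP.
  have x1 : lsubmx x = 0.
    apply: (row_free_inj (A := U *m W)); first by rewrite row_free_unit.
    rewrite mul0mx mulmxA -[RHS](mul0mx _ W) -xP mulmxDl.
    by rewrite -[_ *m K *m W]mulmxA KW mulmx0 addr0.
  move: xP; rewrite x1 mul0mx add0r => xK.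
  suff -> : rsubmx x = 0 by rewrite row_mx0.
  by apply: (row_free_inj (row_base_free (kermx W))); rewrite mul0mx.
have Pfull : row_full P.
  by move: Pfree; rewrite /row_free /row_full => /eqP ->; apply/eqP.
apply: (@tr_similar_conj _ _ _ _ (block_mx J 0 0 B2) P (pinvmx P)).
- exact: mulmxVp.
- exact: mulVpmx.
- by rewrite mul_col_mx mul_block_col UB KB !mul0mx addr0 add0r.
have mn : (m < n.+1)%N by rewrite -kn addSn ltnS leq_addl.
have [S2 S2u BS2] := IH m mn B2.
exists (block_mx (U *m W) 0 0 S2).
  by rewrite unitmxE det_ublock unitrM -!unitmxE UW S2u.
rewrite tr_block_mx !trmx0 !mulmx_block !mul0mx !mulmx0 !addr0 !add0r BS2.
by rewrite mulmxA -UB -!mulmxA BW.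
Qed.

(** * Rank at most one in Lie-theoretic terms *)

Lemma rank_outer (F : fieldType) (m n : nat) (u : 'cV[F]_m) (v : 'rV[F]_n) :
  (\rank (u *m v) <= 1)%N.
Proof. exact: leq_trans (mxrankM_maxl _ _) (rank_leq_col _). Qed.

Lemma rank_le1_outer (F : fieldType) (m n : nat) (X : 'M[F]_(m, n)) :
  (\rank X <= 1)%N -> exists (u : 'cV_m) (v : 'rV_n), X = u *m v.
Proof.
rewrite -{2}(mulmx_base X); move: (col_base X) (row_base X).
case: (\rank X) => [|[|//]] L R _; last by exists L, R.
by exists 0, 0; rewrite (thinmx0 L) !mul0mx.
Qed.

Lemma rank_le1_minor (F : fieldType) (m n : nat) (X : 'M[F]_(m, n)) a b c d :
  (\rank X <= 1)%N -> X a c * X b d = X a d * X b c.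
Proof.
case/rank_le1_outer => u [v ->].
by rewrite !mxE !big_ord1; ring.
Qed.

Lemma entry_mul_delta_mul (R : comNzRingType) (m n p q : nat) (X : 'M[R]_(m, n))
    (Y : 'M[R]_(p, q)) i j k l :
  (X *m delta_mx k l *m Y) i j = X i k * Y l j.
Proof.
rewrite -(mul_delta_mx (0 : 'I_1)) mulmxA -mulmxA -colE -rowE.
by rewrite !mxE big_ord1 !mxE.
Qed.

Lemma mxtrace_outer (R : comNzRingType) (n : nat) (u : 'cV[R]_n) (v : 'rV[R]_n) :
  \tr (u *m v) = (v *m u) 0 0.
Proof. by rewrite mxtrace_mulC trace_mx11. Qed.

(** For [x = u v] of trace zero, [v u = 0] and so [x x = 0]. The double bracket reduces to
    [-2 x y x], where [x y x] is [x] times the scalar [v y u]. *)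
Lemma double_bracket_rank_le1 (F : fieldType) (n : nat) (x y : 'M[F]_n) :
  (\rank x <= 1)%N -> \tr x = 0 ->
  exists c, x *m (x *m y - y *m x) - (x *m y - y *m x) *m x = c *: x.
Proof.
case/rank_le1_outer => u [v ->]; rewrite mxtrace_outer => vu0.
have vu : v *m u = 0 by apply/matrixP=> i j; rewrite !ord1 vu0 mxE.
have xx (w : 'rV_n): u *m v *m (u *m w) = 0.
  by rewrite mulmxA -[u *m v *m u]mulmxA vu mulmx0 mul0mx.
have xyx : u *m v *m (y *m (u *m v)) = (v *m y *m u) 0 0 *: (u *m v).
  rewrite !mulmxA -[u *m v *m y]mulmxA -[u *m (v *m y) *m u]mulmxA.
  by rewrite [v *m y *m u]mx11_scalar mul_mx_scalar -scalemxAl -mx11_scalar.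
exists (- (v *m y *m u) 0 0 - (v *m y *m u) 0 0).
rewrite mulmxBr mulmxBl -!(mulmxA y) xx mulmx0 subr0 -!(mulmxA _ y) xyx.
by rewrite !mulmxA -[_ *m u *m v]mulmxA xx mul0mx sub0r scalerBl scaleNr.
Qed.

Lemma char_poly_trmx (R : comNzRingType) (n : nat) (A : 'M[R]_n) :
  char_poly A^T = char_poly A.
Proof.
rewrite /char_poly -det_tr; congr (\det _).
by apply/matrixP=> i j; rewrite !mxE eq_sym.
Qed.

Section ExtremalRank.
Variables (C : numClosedFieldType) (n : nat) (x : 'M[C]_n.+1).
Hypothesis tr_x : \tr x = 0.

(** The trace is [n.+1] times the only eigenvalue, which must vanish in characteristic zero;
    Cayley-Hamilton concludes. *)
Lemma nilpotent_of_unique_eigenvalue (a : C) :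
  (forall b, eigenvalue x b -> b = a) -> x ^+ n.+1 = 0.
Proof.
move=> ev; case: (closed_field_poly_normal (char_poly x)) => r.
rewrite (monicP (char_poly_monic x)) scale1r => xr.
have ra : r = nseq (size r) a.
  apply/all_pred1P/allP => b br; apply/eqP/ev; rewrite eigenvalue_root_char xr.
  by rewrite root_prod_XsubC.
have sr : size r = n.+1.
  by have := size_char_poly x; rewrite xr size_prod_XsubC => -[].
have a0 : a = 0.
  have := char_poly_trace x (ltn0Sn n); rewrite tr_x oppr0 xr -sr.
  rewrite coefPn_prod_XsubC ?sr // ra big_nseq sr iter_addr_0 => /eqP.
  by rewrite oppr_eq0 -mulr_natr mulf_eq0 pnatr_eq0 orbF => /eqP.
have := Cayley_Hamilton x; rewrite xr ra big_nseq sr a0 subr0.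
by rewrite iter_mulr_1 rmorphXn /= horner_mx_X.
Qed.

(* With two eigenvalues [a <> b], take [y] the product of a [b]-eigencolumn and an
   [a]-eigenrow; otherwise [x] is nilpotent and matrix units suffice. *)
Lemma rank_le1_of_double_bracket :
  (forall y, \tr y = 0 ->
     exists c, x *m (x *m y - y *m x) - (x *m y - y *m x) *m x = c *: x) ->
  (\rank x <= 1)%N.
Proof.
move=> h0.
(* Subtracting a scalar matrix from [y] leaves the bracket unchanged, so the hypothesis extends to
   every [y]. *)
have {h0} h y : exists c, x * x * y - 2 *: (x * y * x) + y * x * x = c *: x.
  pose t := \tr y / n.+1%:R; pose y0 := y - t%:M.
  have try0 : \tr y0 = 0.
    rewrite raddfB /= mxtrace_scalar -mulr_natr divfK ?subrr //.
    by rewrite pnatr_eq0.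
  have [c hc] := h0 y0 try0; exists c; rewrite -hc {hc}.
  have -> : x *m y0 - y0 *m x = x * y - y * x.
    by rewrite mulmxBr mulmxBl -scalar_mxC opprB addrA subrK.
  rewrite !mulmxE mulrBr mulrBl !mulrA scaler_nat mulr2n.
  by rewrite opprB opprD !addrA addrAC.
have [x0|x0] := eqVneq x 0; first by rewrite x0 mxrank0.
have [a ev_a] := eigenvalue_closed x (ltn0Sn n).
have [[b ev_b ab]|uniq_ev] :
    (exists2 b, eigenvalue x b & b != a) \/ (forall b, eigenvalue x b -> b = a).
  have := closed_field_poly_normal (char_poly x) => -[r].
  rewrite (monicP (char_poly_monic x)) scale1r => xr.
  case: (boolP (all (pred1 a) r)) => [/allP ra|/allPn [b br ba]].
    right=> b; rewrite eigenvalue_root_char xr root_prod_XsubC => br.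
    exact/eqP/ra.
  by left; exists b => //; rewrite eigenvalue_root_char xr root_prod_XsubC.
- case/eigenvalueP: ev_a => v vx v0.
  have [u ux u0] : exists2 u : 'cV_n.+1, x *m u = b *: u & u != 0.
    have /eigenvalueP [u ux u0] : eigenvalue x^T b.
      by rewrite eigenvalue_root_char char_poly_trmx -eigenvalue_root_char.
    exists u^T; last by rewrite trmx_eq0.
    by apply: trmx_inj; rewrite trmx_mul trmxK ux linearZ /= trmxK.
  have [c hc] := h (u *m v).
  have xuv : x * (u *m v) = b *: (u *m v) by rewrite -mulmxE mulmxA ux scalemxAl.
  have uvx : u *m v * x = a *: (u *m v) by rewrite -mulmxE -mulmxA vx scalemxAr.
  (* The double bracket scales [u v] by the nonzero factor [(b - a)^2], so [x] is proportional to
     [u v]. *)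
  have uv : x * x * (u *m v) - 2 *: (x * (u *m v) * x) + u *m v * x * x
      = (b - a) ^+ 2 *: (u *m v).
    rewrite -mulrA !xuv -scalerAr xuv -scalerAl !uvx -scalerAl uvx !scalerA.
    by rewrite -scalerBl -scalerDl; congr (_ *: _); ring.
  have c0 : c != 0.
    apply/negP => /eqP c0; move: hc; rewrite uv c0 scale0r => /eqP.
    rewrite scaler_eq0 expf_eq0 subr_eq0 (negPf ab) andbF /=.
    case/matrix0Pn: v0 => i0 [i vi]; case/matrix0Pn: u0 => j [j0 uj].
    move/eqP/matrixP/(_ j i); rewrite !mxE big_ord1 => /eqP.
    by rewrite (ord1 i0) (ord1 j0) in vi uj *; rewrite mulf_eq0 (negPf vi) (negPf uj).
  have -> : x = (c^-1 * (b - a) ^+ 2 *: u) *m v.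
    by rewrite -scalemxAl -scalerA -uv hc scalerA mulVf ?scale1r.
  exact: rank_outer.
have ex : exists k, x ^+ k == 0.
  by exists n.+1; rewrite (nilpotent_of_unique_eigenvalue _ uniq_ev).
case: (ex_minnP ex) => [[|[|k]]].
- by rewrite oner_eq0.
- by rewrite expr1 (negPf x0).
move=> /eqP xk min; have {min} /matrix0Pn [i [j xij]] : x ^+ k.+1 != 0.
  by apply/negP => /min; rewrite ltnn.
(* Multiplying the relation on the left by the last nonzero power of [x] leaves only
   [x^(k+1) y x^2 = 0]. Taking [y] a matrix unit yields a product of an entry of each factor. *)
have xx0 : x * x = 0.
  apply/eqP; apply: contraT => /matrix0Pn [l [m xlm]].
  have [c] := h (delta_mx j l).
  move/(congr1 ( *%R (x ^+ k.+1))); rewrite mulrDr mulrBr -scalerAr.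
  rewrite !mulrA -exprSr xk !mul0r scaler0 subrr add0r -scalerAr -exprSr xk.
  rewrite scaler0 -mulrA => /matrixP /(_ i m) /eqP.
  by rewrite -!mulmxE entry_mul_delta_mul [X in _ == X]mxE mulf_eq0 (negPf xij) mulmxE (negPf xlm).
case/matrix0Pn: x0 => {}i [{}j {}xij].
(* With [x^2 = 0] the relation reads [-2 x E_ji x = c x]. Its left side is a multiple of column [j]
   times row [i], and its [(i, j)] entry is nonzero. *)
have [c] := h (delta_mx j i).
rewrite xx0 mul0r add0r -[_ * x * x]mulrA xx0 mulr0 addr0 => hc.
have c0 : c != 0.
  apply/negP => /eqP c0; move: hc; rewrite c0 scale0r => /matrixP /(_ i j) /eqP.
  rewrite -!mulmxE [X in X == _]mxE [X in - X == _]mxE entry_mul_delta_mul mxE.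
  by rewrite oppr_eq0 !mulf_eq0 pnatr_eq0 (negPf xij).
have -> : x = (c^-1 * - 2 *: col j x) *m row i x.
  rewrite -scalemxAl -scalerA scaleNr colE rowE mulmxA -[x *m _ *m _]mulmxA.
  by rewrite mul_delta_mx mulmxE hc scalerA mulVf ?scale1r.
exact: rank_outer.
Qed.

End ExtremalRank.

Lemma double_bracketP (C : numClosedFieldType) (n : nat) (x : 'M[C]_n) :
  \tr x = 0 ->
  (\rank x <= 1)%N <->
  forall y, \tr y = 0 ->
    exists c, x *m (x *m y - y *m x) - (x *m y - y *m x) *m x = c *: x.
Proof.
move=> trx; split=> [rx y _|]; first exact: double_bracket_rank_le1.
case: n x trx => [x _ _|n x trx]; last exact: rank_le1_of_double_bracket.
by rewrite (leq_trans (rank_leq_row x)).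
Qed.

(** * Linear maps scaling the off-diagonal matrix units *)

(** Lets [ring] deduce one polynomial identity from another by comparing differences; [eq_subr2]
    forms the combinations of hypotheses fed to it. *)
Lemma eq_of_subr (R : pzRingType) (l r a b : R) : l = r -> a - b = l - r -> a = b.
Proof. by move=> -> /eqP; rewrite subrr subr_eq0 => /eqP. Qed.

Lemma eq_subr2 (R : pzRingType) (k l r l' r' : R) :
  l = r -> l' = r' -> l - k * l' = r - k * r'.
Proof. by move=> -> ->. Qed.

Lemma mxtrace_delta (R : nzRingType) (n : nat) (i j : 'I_n) :
  \tr (delta_mx i j : 'M[R]_n) = (i == j)%:R.
Proof.
rewrite /mxtrace (bigD1 i) //= big1 => [|k ki]; last by rewrite mxE (negPf ki).
by rewrite addr0 mxE eqxx.
Qed.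

Arguments eq_subr2 {R} k {l r l' r'}.

(** The difference of the two maps vanishes on off-diagonal units and takes one value [z] on all
    diagonal units, so it sends [x] to [\tr x] times [z]. *)
Lemma eq_on_traceless (R : comNzRingType) (n : nat) (V : lmodType R)
    (L1 L2 : {linear 'M[R]_n -> V}) (i0 : 'I_n) :
  (forall i j, i != j -> L1 (delta_mx i j) = L2 (delta_mx i j)) ->
  (forall i, i != i0 ->
     L1 (delta_mx i i - delta_mx i0 i0) = L2 (delta_mx i i - delta_mx i0 i0)) ->
  forall x, \tr x = 0 -> L1 x = L2 x.
Proof.
move=> eL eH x trx; apply/eqP; rewrite -subr_eq0.
pose z := L1 (delta_mx i0 i0) - L2 (delta_mx i0 i0).
have Lz i j : L1 (delta_mx i j) - L2 (delta_mx i j) = (i == j)%:R *: z.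
  have [<-|ij] := eqVneq i j; last by rewrite scale0r eL ?subrr.
  rewrite scale1r; have [->//|ii0] := eqVneq i i0.
  have := eH i ii0; rewrite !linearB /= => /eqP.
  rewrite -subr_eq0 opprB addrACA => /eqP e; apply/eqP.
  by rewrite -subr_eq0 /z opprB addrACA [X in _ + X]addrC e.
rewrite [x]matrix_sum_delta (linear_sum L1) (linear_sum L2) -sumrB /=.
rewrite (eq_bigr (fun i => x i i *: z)) => [|i _].
  by rewrite -scaler_suml [\sum_i _](trx) scale0r.
rewrite (linear_sum L1) (linear_sum L2) -sumrB /= (bigD1 i) //= big1 => [|j ji].
  by rewrite (linearZ_LR L1) (linearZ_LR L2) -scalerBr Lz eqxx scale1r addr0.
by rewrite (linearZ_LR L1) (linearZ_LR L2) -scalerBr Lz eq_sym (negPf ji) scale0r scaler0.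
Qed.

Section UnitMultiples.
Variables (F : numFieldType) (n : nat) (g : {linear 'M[F]_n -> 'M[F]_n}).
Variable c : 'I_n -> 'I_n -> F.
Hypothesis g_tr : forall x, \tr x = 0 -> \tr (g x) = 0.
Hypothesis g_rank : forall x, \tr x = 0 -> (\rank x <= 1)%N -> (\rank (g x) <= 1)%N.
Hypothesis g_delta : forall i j, i != j -> g (delta_mx i j) = c i j *: delta_mx i j.
Hypothesis c_neq0 : forall i j, i != j -> c i j != 0.

Local Notation E := (@delta_mx F n n).

Section Coroot.
Variables (i k : 'I_n).
Hypothesis ik : i != k.
Let ki : k != i. Proof. by rewrite eq_sym. Qed.

Let H := g (E i i - E k k).
Let X s : 'M_n := s *: H - c i k *: E i k + s ^+ 2 *: (c k i *: E k i).

(* [X s] is the image of the traceless matrix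
   [(e_i + s e_k) (s e_i - e_k)^T] of rank one. *)
Let X_rank s : (\rank (X s) <= 1)%N.
Proof.
have -> : X s = g ((delta_mx i (0 : 'I_1) + s *: delta_mx k 0)
                *m (s *: delta_mx 0 i - delta_mx 0 k)).
  rewrite mulmxDl !mulmxBr -!scalemxAl -!scalemxAr !mul_delta_mx scalerA.
  rewrite /X /H -(g_delta _ _ ik) -(g_delta _ _ ki).
  rewrite -!linearZ -linearB -linearD /=; congr (g _).
  by apply/matrixP=> a b; rewrite !mxE; ring.
apply: g_rank; last exact: rank_outer.
rewrite mxtrace_outer mulmxDr !mulmxBl -!scalemxAl -!scalemxAr.
rewrite !mul_delta_mx !mul_delta_mx_0 //.
by rewrite !mxE; ring.
Qed.

Let X_entry s a b : X s a b = s * H a b - c i k * ((a == i) && (b == k))%:R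
  + s ^+ 2 * (c k i * ((a == k) && (b == i))%:R).
Proof. by rewrite /X !mxE. Qed.

Let minorX s a b a' b' : X s a b * X s a' b' = X s a b' * X s a' b.
Proof. exact: rank_le1_minor. Qed.

(** The minor through the entry [(i, k)], where the constant term of [X s] sits, is polynomial in
    [s]. Its odd part, isolated by [s = 1] and [s = -1], is [c i k * H a b] up to sign. [H0r] does
    the same through [(k, i)]. *)
Let H0l a b : a != i -> b != k -> ~~ ((a == k) && (b == i)) -> H a b = 0.
Proof.
move=> ai bk ab; apply/eqP.
have := minorX 1 i k a b; have := minorX (-1) i k a b.
rewrite !X_entry !eqxx (negPf ab) (negPf ai) (negPf bk) (negPf ik) ?(negPf ki).
rewrite !andbF /= => e1 e2.
have : 2 * c i k * H a b = 0.
  by apply: (@eq_of_subr F _ _ _ _ (eq_subr2 1 e1 e2)); ring.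
by move/eqP; rewrite !mulf_eq0 pnatr_eq0 (negPf (c_neq0 _ _ ik)).
Qed.

Let H0r a b : a != k -> b != i -> ~~ ((a == i) && (b == k)) -> H a b = 0.
Proof.
move=> ak bi ab; apply/eqP.
have := minorX 1 k i a b; have := minorX (-1) k i a b.
rewrite !X_entry !eqxx (negPf ab) (negPf ak) (negPf bi) (negPf ki) ?(negPf ik).
rewrite !andbF /= => e1 e2.
have : 2 * c k i * H a b = 0.
  by apply: (@eq_of_subr F _ _ _ _ (eq_subr2 1 e2 e1)); ring.
by move/eqP; rewrite !mulf_eq0 pnatr_eq0 (negPf (c_neq0 _ _ ki)).
Qed.

Lemma coroot_image :
  exists h, g (E i i - E k k) = h *: (E i i - E k k) /\ h ^+ 2 = c i k * c k i.
Proof.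
have Htr : H k k = - H i i.
  have : \tr H = 0.
    by apply: g_tr; rewrite raddfB /= !mxtrace_delta !eqxx subrr.
  rewrite /mxtrace (bigD1 i) //= (bigD1 k) //= big1 => [|a /andP[ai ak]].
    by rewrite addr0 => /eqP; rewrite addrC addr_eq0 => /eqP.
  by apply: H0l; rewrite ?(negPf ak).
have e s : (s * H i k - c i k) * (s * H k i + s ^+ 2 * c k i) = - s ^+ 2 * H i i ^+ 2.
  have := minorX s i k k i; rewrite !X_entry !eqxx (negPf ik) (negPf ki) /= Htr.
  by move=> em; apply: (@eq_of_subr F _ _ _ _ em); ring.
(* The identity is a cubic in [s]. The four values separate its coefficients of [s] and [s^3], which
   give [H k i = 0] and [H i k = 0]; what remains is the relation for the square of [H i i]. *)
have e1 := e 1; have e2 := e (-1); have e3 := e 2; have e4 := e (-2).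
have Hik : H i k = 0.
  apply/eqP; have : 12 * c k i * H i k = 0.
    apply: (@eq_of_subr F _ _ _ _ (eq_subr2 2 (eq_subr2 1 e3 e4) (eq_subr2 1 e1 e2))).
    ring.
  by move/eqP; rewrite !mulf_eq0 pnatr_eq0 (negPf (c_neq0 _ _ ki)).
have Hki : H k i = 0.
  apply/eqP; have : 12 * c i k * H k i = 0.
    apply: (@eq_of_subr F _ _ _ _ (eq_subr2 8 (eq_subr2 1 e3 e4) (eq_subr2 1 e1 e2))).
    ring.
  by move/eqP; rewrite !mulf_eq0 pnatr_eq0 (negPf (c_neq0 _ _ ik)).
exists (H i i); split; last by rewrite Hik Hki in e1; apply: (@eq_of_subr F _ _ _ _ e1); ring.
apply/matrixP=> a b; rewrite -/H !mxE.
have [->|ai] := eqVneq a i; have [->|bi] := eqVneq b i;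
  rewrite ?(negPf ik) ?(negPf ki) /= ?andbF ?subr0 ?mulr1 ?mulr0 //.
- have [->|bk] := eqVneq b k; first by rewrite Hik.
  by rewrite H0r // ?(negPf bk) ?andbF.
- have [->|ak] := eqVneq a k; first by rewrite Hki.
  by rewrite H0l // ?(negPf ak).
have [->|ak] := eqVneq a k; have [->|bk] := eqVneq b k => /=.
- by rewrite Htr sub0r mulrN1.
- by rewrite subrr mulr0 H0l // ?(negPf bi) ?andbF.
- by rewrite subrr mulr0 H0r // ?(negPf ai).
by rewrite subrr mulr0 H0r // ?(negPf ai).
Qed.
End Coroot.

Let h i k := g (E i i - E k k) i i.

Lemma coroot_scalar i k : i != k ->
  g (E i i - E k k) = h i k *: (E i i - E k k) /\ h i k ^+ 2 = c i k * c k i.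
Proof.
move=> ik; have [t [e te]] := coroot_image _ _ ik.
suff -> : h i k = t by [].
by rewrite /h e !mxE eqxx (negPf ik) subr0 mulr1.
Qed.

(** [E i i - E j j] is the sum of [E i i - E k k] and [E k k - E j j], and the image of the latter
    has no [(i, i)] entry. *)
Lemma coroot_scalar_right i j k : i != j -> i != k -> h i j = h i k.
Proof.
move=> ij ik; have [->//|jk] := eqVneq j k.
have kj : k != j by rewrite eq_sym.
have [e _] := coroot_scalar _ _ kj.
have -> : h i j = g ((E i i - E k k) + (E k k - E j j)) i i.
  by rewrite addrA subrK.
rewrite linearD /= e mxE -/(h i k) !mxE (negPf ij) (negPf ik).
by rewrite subrr mulr0 addr0.
Qed.

Lemma coroot_scalarC i j : h i j = h j i.
Proof.
have [->//|ij] := eqVneq i j.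
have ji : j != i by rewrite eq_sym.
have [e _] := coroot_scalar _ _ ji; rewrite {1}/h -opprB linearN e.
by rewrite !mxE eqxx (negPf ij) sub0r mulrN1 opprK.
Qed.

(** This is the minor on rows [i], [k] and columns [i], [j] of the image of the traceless rank-one
    matrix [(e_i + e_k) (e_j + e_i - e_k)^T]. *)
Lemma coefficient_cocycle i j k : i != j -> i != k -> j != k ->
  h i k * c k j = c i j * c k i.
Proof.
move=> ij ik jk; have ji : j != i by rewrite eq_sym.
have ki : k != i by rewrite eq_sym.
have kj : k != j by rewrite eq_sym.
pose y := (delta_mx i (0 : 'I_1) + delta_mx k 0)
            *m (delta_mx 0 j + (delta_mx 0 i - delta_mx 0 k)) : 'M[F]_n.
have gy : g y = c i j *: E i j + c k j *: E k j + h i k *: (E i i - E k k)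
                - c i k *: E i k + c k i *: E k i.
  have [<- _] := coroot_scalar _ _ ik.
  rewrite -(g_delta _ _ ij) -(g_delta _ _ kj) -(g_delta _ _ ik) -(g_delta _ _ ki).
  rewrite -!linearD -linearB -linearD; congr (g _).
  rewrite /y mulmxDl !mulmxDr !mulmxN !mul_delta_mx.
  by apply/matrixP=> a b; rewrite !mxE; ring.
have try0 : \tr y = 0.
  rewrite mxtrace_outer mulmxDr !mulmxDl !mulNmx !mul_delta_mx.
  by rewrite !mul_delta_mx_0 // !mxE; ring.
have := @rank_le1_minor _ _ _ _ i k i j (g_rank _ try0 (rank_outer _ _ _ _ _)).
rewrite gy !mxE !eqxx (negPf ij) (negPf ik) (negPf jk) (negPf ki) (negPf ji) /= => e.
by apply: (@eq_of_subr F _ _ _ _ e); ring.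
Qed.

(** All coroots share one scalar [p], and the cocycle relation then makes [c i j] equal to
    [p * d i / d j]: the map is [p] times conjugation by a diagonal matrix. *)
Lemma unit_multiples_conj (i0 i1 : 'I_n) : i0 != i1 ->
  exists p (a : 'M[F]_n), a \in unitmx /\
    forall x, \tr x = 0 -> g x *m a = p *: (a *m x).
Proof.
move=> i01; pose p := h i0 i1.
have hE i k : i != k -> h i k = p.
  move=> ik; have [ii0|ii0] := eqVneq i i0.
    by rewrite ii0 in ik *; apply: coroot_scalar_right.
  rewrite (coroot_scalar_right i k i0) // coroot_scalarC.
  by apply: coroot_scalar_right; rewrite // eq_sym.
have p2 i k : i != k -> c i k * c k i = p ^+ 2.
  by move=> ik; have [_ <-] := coroot_scalar _ _ ik; rewrite hE.
have p0 : p != 0.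
  rewrite -sqrf_eq0 -(p2 _ _ i01) mulf_neq0 // c_neq0 // eq_sym //.
(* The weights are column [i0] of [c]. Nothing is known about its diagonal entry, which is replaced
   by [p] so that [cd] also holds when [i] or [j] is [i0]. *)
pose d i := if i == i0 then p else c i i0.
have d0 i : d i != 0 by rewrite /d; have [_|ii0] := eqVneq i i0; [exact: p0|exact: c_neq0].
have cd i j : i != j -> c i j * d j = p * d i.
  rewrite /d => ij; have [ji0|ji0] := eqVneq j i0.
    by rewrite ji0 in ij *; rewrite (negPf ij) mulrC.
  have [ii0|ii0] := eqVneq i i0; first by rewrite ii0 p2 // -ii0.
  have i0j : i0 != j by rewrite eq_sym.
  have i0i : i0 != i by rewrite eq_sym.
  have ji : j != i by rewrite eq_sym.
  apply: (mulfI (c_neq0 _ _ i0j)).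
  have e := coefficient_cocycle i0 j i i0j i0i ji; rewrite (hE _ _ i0i) in e.
  by rewrite mulrCA p2 // [RHS]mulrCA -e; ring.
pose D := diag_mx (\row_i d i).
have DE i j : E i j *m D = d j *: E i j /\ D *m E i j = d i *: E i j.
  split; apply/matrixP=> a b.
    rewrite mul_mx_diag !mxE; have [->|] := eqVneq b j; first by rewrite mulrC.
    by rewrite andbF mul0r mulr0.
  rewrite mul_diag_mx !mxE; have [->|] := eqVneq a i; first by [].
  by rewrite !mulr0.
exists p, D; split.
  by rewrite unitmxE det_diag unitfE prodf_seq_neq0; apply/allP=> i _; rewrite mxE d0.
move=> x trx.
apply: (eq_on_traceless _ _ _ (mulmxr D \o g) (p \*: mulmx D) i0) => // [i j ij|i ii0] /=.
  rewrite g_delta // -scalemxAl (DE i j).1 (DE i j).2 !scalerA cd //.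
have [-> _] := coroot_scalar _ _ ii0.
rewrite hE // -scalemxAl mulmxBl mulmxBr.
by rewrite !(DE _ _).1 !(DE _ _).2.
Qed.

End UnitMultiples.

(** * Images of the matrix units under a rank-one preserver *)

(** With [X = u a] and [Y = w b], the sum is the product of [row_mx u w] and [col_mx a b], which has
    rank two unless [a], [b] or [u], [w] are proportional. *)
Lemma rank_le1_add_cases (F : fieldType) (m n : nat) (X Y : 'M[F]_(m, n)) :
  X != 0 -> Y != 0 ->
  (\rank X <= 1)%N -> (\rank Y <= 1)%N -> (\rank (X + Y)%R <= 1)%N ->
  (X == Y)%MS \/ (X^T == Y^T)%MS.
Proof.
move=> X0 Y0 rX rY rXY.
have rk (Z : 'M_(m, n)) : Z != 0 -> (\rank Z <= 1)%N -> \rank Z = 1%N.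
  by rewrite -mxrank_eq0; case: (\rank Z) => [|[|]].
have eqX (m' n' : nat) (Z W : 'M[F]_(m', n')) :
    \rank Z = 1%N -> \rank W = 1%N -> (W <= Z)%MS -> (Z == W)%MS.
  by move=> rZ rW s; rewrite s andbT -(mxrank_leqif_sup s) rZ rW.
have := rank_le1_outer _ _ _ _ rX => -[u [a Xua]].
have := rank_le1_outer _ _ _ _ rY => -[w [b Ywb]].
have a0 : a != 0 by apply: contra_neq X0 => a0; rewrite Xua a0 mulmx0.
have u0 : u != 0 by apply: contra_neq X0 => u0; rewrite Xua u0 mul0mx.
have [sub|nsub] := boolP (b <= a)%MS.
  left; apply: eqX; [exact: rk|exact: rk|rewrite Ywb].
  case/sub_rVP: sub => k ->.
  case/matrix0Pn: u0 => i [j uij]; rewrite (ord1 j) in uij.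
  have -> : a = (u i 0)^-1 *: row i X.
    by rewrite Xua row_mul [row i u]mx11_scalar mul_scalar_mx mxE scalerA mulVf ?scale1r.
  by rewrite scalerA -scalemxAr scalemx_sub // mulmx_sub // row_sub.
right; suff wu : (w^T <= u^T)%MS.
  apply: eqX; [by rewrite mxrank_tr; exact: rk|by rewrite mxrank_tr; exact: rk|].
  rewrite Ywb trmx_mul.
  case/sub_rVP: wu => k ->; case/matrix0Pn: a0 => i [j aij].
  rewrite (ord1 i) in aij.
  have -> : u^T = (a 0 j)^-1 *: row j X^T.
    rewrite Xua trmx_mul row_mul [row j _]mx11_scalar mul_scalar_mx !mxE scalerA.
    by rewrite mulVf ?scale1r.
  by rewrite scalerA -scalemxAr scalemx_sub // mulmx_sub // row_sub.
have XY : X + Y = row_mx u w *m col_mx a b by rewrite mul_row_col Xua Ywb.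
have := rXY; rewrite XY => rk1.
apply: contraLR rk1 => nwu; rewrite -ltnNge.
have free2 (k : nat) (x y : 'rV[F]_k) : x != 0 -> ~~ (y <= x)%MS -> row_free (col_mx x y).
  move=> x0 nyx; apply: inj_row_free => z.
  rewrite -[z]hsubmxK mul_row_col [lsubmx z]mx11_scalar [rsubmx z]mx11_scalar.
  rewrite !mul_scalar_mx; set s := lsubmx z 0 0; set t := rsubmx z 0 0 => e.
  have t0 : t = 0.
    apply/eqP; apply: contraNT nyx => t0; apply/sub_rVP; exists (- t^-1 * s).
    rewrite -scalerA -[in RHS](addrK (t *: y) (s *: x)) e sub0r scalerN scaleNr.
    by rewrite opprK scalerA mulVf ?scale1r.
  move: e; rewrite t0 scale0r addr0 => /eqP.
  by rewrite scaler_eq0 (negPf x0) orbF => /eqP ->; rewrite !raddf0 row_mx0.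
rewrite mxrankMfree ?free2 // -mxrank_tr tr_row_mx.
have uT0 : u^T != 0 by rewrite trmx_eq0.
by have := free2 _ _ _ uT0 nwu; rewrite /row_free => /eqP ->.
Qed.

Lemma rank_le1_add_eqmx (F : fieldType) (m n : nat) (X Y : 'M[F]_(m, n)) :
  (\rank X <= 1)%N -> (X == Y)%MS -> (\rank (X + Y)%R <= 1)%N.
Proof.
move=> rX /andP[_ YX]; apply: leq_trans rX; apply: mxrankS.
by rewrite addmx_sub ?submx_refl.
Qed.

(** * Row and column spaces over the grid of off-diagonal positions *)

Section Grid.
Variables (F : fieldType) (n : nat) (P : 'I_n -> 'I_n -> 'M[F]_n).
Hypothesis P_neq0 : forall i j, i != j -> P i j != 0.
Hypothesis P_rank : forall i j, i != j -> (\rank (P i j) <= 1)%N.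
Hypothesis P_row : forall i j k, i != j -> i != k -> j != k ->
  (\rank (P i j + P i k)%R <= 1)%N.
Hypothesis P_col : forall i j k, i != k -> j != k -> i != j ->
  (\rank (P i k + P j k)%R <= 1)%N.
Hypothesis P_corner : forall i j k l, i != j -> i != k -> l != j -> k != j ->
  l != i -> (1 < \rank (P i k + P l j)%R)%N.

Let R (X Y : 'M[F]_n) := (X == Y)%MS.
Let T (X Y : 'M[F]_n) := (X^T == Y^T)%MS.

Let row_cases i j k : i != j -> i != k -> j != k ->
  R (P i j) (P i k) \/ T (P i j) (P i k).
Proof. by move=> ij ik jk; apply: rank_le1_add_cases; auto. Qed.

Let col_cases i j k : i != k -> j != k -> i != j ->
  R (P i k) (P j k) \/ T (P i k) (P j k).
Proof. by move=> ik jk ij; apply: rank_le1_add_cases; auto. Qed.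

(** If both edges at [(i, j)] shared their row space, [P i k] and [P l j] would share it too and
    their sum would have rank at most one. *)
Let corner_R i j k l : i != j -> i != k -> l != j -> k != j -> l != i ->
  R (P i j) (P i k) -> R (P i j) (P l j) -> False.
Proof.
move=> ij ik lj kj li /eqmxP e1 /eqmxP e2.
have := P_corner _ _ _ _ ij ik lj kj li; rewrite ltnNge rank_le1_add_eqmx ?P_rank //.
by apply/eqmxP; apply: eqmx_trans (eqmx_sym e1) e2.
Qed.

Let corner_T i j k l : i != j -> i != k -> l != j -> k != j -> l != i ->
  T (P i j) (P i k) -> T (P i j) (P l j) -> False.
Proof.
move=> ij ik lj kj li /eqmxP e1 /eqmxP e2.
have := P_corner _ _ _ _ ij ik lj kj li.
rewrite ltnNge -mxrank_tr raddfD /= rank_le1_add_eqmx ?mxrank_tr ?P_rank //.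
by apply/eqmxP; apply: eqmx_trans (eqmx_sym e1) e2.
Qed.

(* Neighbours in a row or column of the grid share their row space ([R]) or their
   column space ([T]); by [P_corner] the two edges at a corner never share the
   same one, so the label of a single edge determines all the others. *)
Lemma grid_dichotomy :
  (forall i j k, i != j -> i != k -> T (P i j) (P i k)) /\
  (forall i j k, i != k -> j != k -> R (P i k) (P j k)) \/
  (forall i j k, i != j -> i != k -> R (P i j) (P i k)) /\
  (forall i j k, i != k -> j != k -> T (P i k) (P j k)).
Proof.
have Rs X Y : R X Y -> R Y X by rewrite /R andbC.
have Ts X Y : T X Y -> T Y X by rewrite /T andbC.
have sy (i j : 'I_n) : i != j -> j != i by rewrite eq_sym.
(* [S i j] says that every row edge at the position [(i, j)] has label [R]. *)
pose S i j := i != j /\ forall k, i != k -> j != k -> R (P i j) (P i k).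
have colT i j k l : i != j -> i != k -> j != k -> l != i -> l != j ->
    R (P i j) (P i k) -> T (P i j) (P l j).
  move=> ij ik jk li lj r; have [r'|//] := col_cases i l j ij lj (sy _ _ li).
  by case: (corner_R i j k l); auto.
have rowR i j k l : i != j -> i != k -> j != k -> l != i -> l != j ->
    T (P i j) (P l j) -> R (P i j) (P i k).
  move=> ij ik jk li lj t; have [//|t'] := row_cases i j k ij ik jk.
  by case: (corner_T i j k l); auto.
(* A single [R] edge forces [T] on a column edge at the same position, which in turn forces [R] on
   every other row edge there. *)
have S_edge i j k : i != j -> i != k -> j != k -> R (P i j) (P i k) -> S i j.
  move=> ij ik jk r; split=> // k' ik' jk'.
  by apply: (rowR i j k' k); auto; apply: (colT i j k k); auto.
case: (pickP [pred t : 'I_n * 'I_n * 'I_n |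
   [&& t.1.1 != t.1.2, t.1.1 != t.2, t.1.2 != t.2 & R (P t.1.1 t.1.2) (P t.1.1 t.2)]]).
  move=> [[i j] k] /= /and4P[ij ik jk r]; right.
  have S_row a b c : S a b -> a != c -> b != c -> S a c.
    move=> [ab h] ac bc; apply: (S_edge a c b); auto.
  have S_col a b c : S a b -> c != a -> c != b -> S c b.
    move=> [ab h] ca cb; split=> // d cd bd.
    apply: (rowR c b d a); auto; apply: Ts; apply: (colT a b c c); auto.
  have Sij := S_edge _ _ _ ij ik jk r.
  (* Row and column moves from [(i, j)] reach every off-diagonal position. Row [j] has no position
     in column [j] and is entered through column [k]. *)
  have Sall a b : a != b -> S a b.
    move=> ab.
    have [aj|aj] := eqVneq a j.
      rewrite {}aj in ab *; have Sjk : S j k.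
        by apply: (S_col i); auto; apply: (S_row i j); auto.
      by have [<-//|kb] := eqVneq k b; apply: (S_row j k); auto.
    have Saj : S a j by have [->//|ai] := eqVneq a i; apply: (S_col i); auto.
    by have [<-//|jb] := eqVneq j b; apply: (S_row a j); auto.
  split=> a b c ab ac.
    have [->|bc] := eqVneq b c; first by rewrite /R submx_refl.
    by have [_] := Sall a b ab; apply.
  have [->|bc] := eqVneq a b; first by rewrite /T submx_refl.
  have [_ h] := Sall a c ab; apply: (colT a c b b); auto.
(* When [n = 2] no triple of distinct indices exists, so that case ends here with all edges
   trivial. *)
move=> none; left.
have rT i j k : i != j -> i != k -> T (P i j) (P i k).
  move=> ij ik; have [->|jk] := eqVneq j k; first by rewrite /T submx_refl.
  have [r|//] := row_cases i j k ij ik jk.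
  by have := none (i, j, k); rewrite /= ij ik jk r.
split=> // i j k ik jk; have [->|ij] := eqVneq i j; first by rewrite /R submx_refl.
have [//|t] := col_cases i j k ik jk ij.
by case: (corner_T i k j j); auto.
Qed.

End Grid.

Lemma outer_of_sub (F : fieldType) (m n : nat) (X : 'M[F]_(m, n))
    (p : 'cV[F]_m) (q : 'rV[F]_n) :
  (X <= q)%MS -> (X^T <= p^T)%MS -> exists c, X = c *: (p *m q).
Proof.
move=> Xq /submxP [D XD].
have Xp : X = p *m D^T by rewrite -[X]trmxK XD trmx_mul trmxK.
exists ((D^T *m pinvmx q) 0 0).
rewrite -[LHS](mulmxKpV Xq) {1}Xp -[p *m _ *m _]mulmxA.
by rewrite scalemxAl -mul_mx_scalar -mx11_scalar.
Qed.

(** * Linear bijections of traceless matrices preserving rank at most one *)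

Section RankOnePreserver.
Variables (F : numFieldType) (n : nat) (f : {linear 'M[F]_n -> 'M[F]_n}).
Hypothesis f_tr : forall x, \tr x = 0 -> \tr (f x) = 0.
Hypothesis f_rank : forall x, \tr x = 0 -> (\rank (f x) <= 1)%N = (\rank x <= 1)%N.
Hypothesis f_surj : forall y, \tr y = 0 -> exists2 x, \tr x = 0 & f x = y.

Local Notation E := (@delta_mx F n n).

Let tr_delta i j : i != j -> \tr (E i j) = 0.
Proof. by move=> ij; rewrite mxtrace_delta (negPf ij). Qed.

Let tr_deltaD i j k l : i != j -> k != l -> \tr (E i j + E k l) = 0.
Proof. by move=> ij kl; rewrite raddfD /= !tr_delta ?addr0. Qed.

Section Basis.
Variables (p : 'I_n -> 'cV[F]_n) (q : 'I_n -> 'rV[F]_n) (c : 'I_n -> 'I_n -> F).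
Hypothesis f_delta : forall i j, i != j -> f (E i j) = c i j *: (p i *m q j).
Hypothesis c_neq0 : forall i j, i != j -> c i j != 0.
Hypothesis p_neq0 : forall i, p i != 0.
Hypothesis q_neq0 : forall i, q i != 0.

(** Tracelessness of the image of [E i j] is orthogonality of [q j] and [p i]. With [qp_diag] this
    makes the two families dual bases up to scaling. *)
Let qp_neq i j : i != j -> (q j *m p i) 0 0 = 0.
Proof.
move=> ij; have := f_tr _ (tr_delta _ _ ij).
rewrite f_delta // mxtraceZ mxtrace_outer => /eqP.
by rewrite mulf_eq0 (negPf (c_neq0 _ _ ij)) => /eqP.
Qed.

(* Otherwise [p j *m q j] would be the image of a traceless [x] such that [x],
   [x + E i j] and [x + E j k] all have rank at most one, forcing [x = 0]. *)
Let qp_diag j : (q j *m p j) 0 0 != 0.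
Proof.
apply/negP => /eqP qp0.
have [x trx fx] : exists2 x, \tr x = 0 & f x = p j *m q j.
  by apply: f_surj; rewrite mxtrace_outer.
have rx : (\rank x <= 1)%N by rewrite -f_rank // fx rank_outer.
have rxl i : i != j -> (\rank (x + E i j)%R <= 1)%N.
  move=> ij; rewrite -f_rank; last by rewrite raddfD /= trx tr_delta ?addr0.
  by rewrite raddfD /= fx f_delta // scalemxAl -mulmxDl rank_outer.
have rxr k : j != k -> (\rank (x + E j k)%R <= 1)%N.
  move=> jk; rewrite -f_rank; last by rewrite raddfD /= trx tr_delta ?addr0.
  by rewrite raddfD /= fx f_delta // scalemxAr -mulmxDr rank_outer.
(* Adding a matrix unit in row or column [j] changes a suitable vanishing minor of [x] by exactly
   [x a b]. *)
have x_off a b : a != b -> x a b = 0.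
  move=> ab; have [bj|bj] := eqVneq b j.
    rewrite {}bj in ab *; have ja : j != a by rewrite eq_sym.
    have := rank_le1_minor _ _ _ _ a j j a (rxr a ja).
    have := rank_le1_minor _ _ _ _ a j j a rx.
    rewrite !mxE !eqxx (negPf ab) (negPf ja) /= => e1 e2.
    by apply: (@eq_of_subr F _ _ _ _ (eq_subr2 1 e2 e1)); ring.
  have ba : b != a by rewrite eq_sym.
  have := rank_le1_minor _ _ _ _ a b b j (rxl b bj).
  have := rank_le1_minor _ _ _ _ a b b j rx.
  rewrite !mxE !eqxx (negPf ab) (negPf bj) /= => e1 e2.
  by apply: (@eq_of_subr F _ _ _ _ (eq_subr2 1 e2 e1)); ring.
(* The minors give [x a a * x b b = 0] for [b != a], so the square of [x a a] equals [x a a] times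
   the trace. *)
have x_diag a : x a a = 0.
  apply/eqP; rewrite -sqrf_eq0 expr2.
  have : x a a * \tr x = 0 by rewrite trx mulr0.
  rewrite /mxtrace (bigD1 a) //= mulrDr mulr_sumr big1 ?addr0 => [->//|b ba].
  by rewrite (rank_le1_minor _ _ _ _ a b a b rx) x_off ?mul0r // eq_sym.
have x0 : x = 0.
  apply/matrixP=> a b; rewrite mxE.
  by have [->|ab] := eqVneq a b; [exact: x_diag|exact: x_off].
case/matrix0Pn: (p_neq0 j) => a [b pab]; rewrite (ord1 b) in pab.
case/matrix0Pn: (q_neq0 j) => a' [b' qab]; rewrite (ord1 a') in qab.
move/matrixP/(_ a b'): fx; rewrite x0 linear0 !mxE big_ord1 => /esym/eqP.
by rewrite mulf_eq0 (negPf pab) (negPf qab).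
Qed.

(** [B A] is diagonal with nonzero entries, so [A] is invertible. Conjugating by it turns the image
    of each off-diagonal [E i j] into a multiple of [E i j]. *)
Lemma basis_conj (i0 i1 : 'I_n) : i0 != i1 ->
  exists t (a : 'M[F]_n), a \in unitmx /\
    forall x, \tr x = 0 -> f x *m a = t *: (a *m x).
Proof.
move=> i01; pose A := \matrix_(a, i) p i a 0; pose B := \matrix_(j, b) q j 0 b.
pose d j := (q j *m p j) 0 0.
have BA : B *m A = diag_mx (\row_j d j).
  apply/matrixP=> j i; rewrite !mxE.
  have -> : \sum_k B j k * A k i = (q j *m p i) 0 0.
    by rewrite mxE; apply: eq_bigr => k _; rewrite !mxE.
  by have [<-|ji] := eqVneq j i; rewrite ?mulr1n // mulr0n qp_neq // eq_sym.
have Au : A \in unitmx.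
  have : B *m A \in unitmx.
    rewrite BA unitmxE det_diag unitfE prodf_seq_neq0; apply/allP=> i _.
    by rewrite mxE qp_diag.
  by rewrite unitmx_mul => /andP[].
have Ap i : invmx A *m p i = delta_mx i 0.
  have -> : p i = A *m delta_mx i 0.
    by rewrite -colE; apply/matrixP=> a b; rewrite !mxE (ord1 b).
  by rewrite mulKmx.
have qA j : q j *m A = d j *: delta_mx 0 j.
  have -> : q j = row j B by apply/matrixP=> a b; rewrite !mxE (ord1 a).
  by rewrite -row_mul BA row_diag_mx mxE.
pose g : {linear 'M[F]_n -> 'M[F]_n} := mulmxr A \o (mulmx (invmx A) \o f).
have gE x : g x = invmx A *m f x *m A by [].
have gdelta i j : i != j -> g (E i j) = (c i j * d j) *: E i j.
  move=> ij; rewrite gE f_delta // -scalemxAr -scalemxAl !mulmxA Ap -mulmxA qA.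
  by rewrite -scalemxAr mul_delta_mx scalerA.
have [|||t [D [Du gD]]] := @unit_multiples_conj F n g (fun i j => c i j * d j) _ _ gdelta _ _ _ i01.
- by move=> x trx; rewrite gE mxtrace_mulC mulmxA mulmxV // mul1mx f_tr.
- move=> x trx rx; rewrite gE; apply: leq_trans (mxrankM_maxl _ _) _.
  by apply: leq_trans (mxrankM_maxr _ _) _; rewrite f_rank.
- by move=> i j ij; rewrite mulf_neq0 ?c_neq0 ?qp_diag.
exists t, (A *m D); rewrite unitmx_mul Au Du; split=> // x trx.
have := congr1 (mulmx A) (gD x trx); rewrite gE -scalemxAr !mulmxA => <-.
by rewrite mulmxV // mul1mx.
Qed.
End Basis.


Hypothesis f_inj : forall x, \tr x = 0 -> f x = 0 -> x = 0.

Let P i j := f (E i j).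

Let P_neq0 i j : i != j -> P i j != 0.
Proof.
move=> ij; apply/negP => /eqP /(f_inj _ (tr_delta _ _ ij)) /matrixP /(_ i j) /eqP.
by rewrite !mxE !eqxx oner_eq0.
Qed.

Let P_rank i j : i != j -> (\rank (P i j) <= 1)%N.
Proof. by move=> ij; rewrite f_rank ?tr_delta // mxrank_delta. Qed.

Let P_row i j k : i != j -> i != k -> j != k -> (\rank (P i j + P i k)%R <= 1)%N.
Proof.
move=> ij ik _; rewrite -raddfD f_rank ?tr_deltaD //=.
rewrite -(mul_delta_mx (0 : 'I_1) i j) -(mul_delta_mx (0 : 'I_1) i k) -mulmxDr.
exact: rank_outer.
Qed.

Let P_col i j k : i != k -> j != k -> i != j -> (\rank (P i k + P j k)%R <= 1)%N.
Proof.
move=> ik jk _; rewrite -raddfD f_rank ?tr_deltaD //=.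
rewrite -(mul_delta_mx (0 : 'I_1) i k) -(mul_delta_mx (0 : 'I_1) j k) -mulmxDl.
exact: rank_outer.
Qed.

Let P_corner i j k l : i != j -> i != k -> l != j -> k != j -> l != i ->
  (1 < \rank (P i k + P l j)%R)%N.
Proof.
move=> ij ik lj kj li; rewrite ltnNge -raddfD f_rank ?tr_deltaD //=.
have il : i != l by rewrite eq_sym.
have jk : j != k by rewrite eq_sym.
apply/negP => /(rank_le1_minor _ _ _ _ i l k j)/eqP.
rewrite !mxE !eqxx (negPf il) (negPf li) (negPf kj) (negPf jk) /=.
by rewrite !(addr0, add0r, mulr1, mul0r) oner_eq0.
Qed.

(** The column space of [P i j] depends only on [i] and its row space only on [j]; spanning vectors
    [p i] and [q j] are read off one image each. *)
Lemma row_col_conj (i0 i1 : 'I_n) : i0 != i1 ->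
  (forall i j k, i != j -> i != k -> ((P i j)^T == (P i k)^T)%MS) ->
  (forall i j k, i != k -> j != k -> (P i k == P j k)%MS) ->
  exists t (a : 'M[F]_n), a \in unitmx /\
    forall x, \tr x = 0 -> f x *m a = t *: (a *m x).
Proof.
move=> i01 colP rowP.
have other (i : 'I_n) : exists j, i != j.
  by have [->|ii0] := eqVneq i i0; [exists i1|exists i0].
have ex_p i : exists p : 'cV[F]_n, p != 0 /\ forall j, i != j -> ((P i j)^T <= p^T)%MS.
  have [k ik] := other i; have [u [v Puv]] := rank_le1_outer _ _ _ _ (P_rank i k ik).
  exists u; split=> [|j ij].
    by apply: contra_neq (P_neq0 _ _ ik) => u0; rewrite Puv u0 mul0mx.
  have /andP[s _] := colP i j k ij ik; apply: submx_trans s _.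
  by rewrite Puv trmx_mul submxMl.
have ex_q j : exists q : 'rV[F]_n, q != 0 /\ forall i, i != j -> (P i j <= q)%MS.
  have [k jk] := other j; have kj : k != j by rewrite eq_sym.
  have [u [v Puv]] := rank_le1_outer _ _ _ _ (P_rank k j kj).
  exists v; split=> [|i ij].
    by apply: contra_neq (P_neq0 _ _ kj) => v0; rewrite Puv v0 mulmx0.
  have /andP[s _] := rowP i k j ij kj; apply: submx_trans s _.
  by rewrite Puv submxMl.
have [p hp] := fin_all_exists ex_p; have [q hq] := fin_all_exists ex_q.
have ex_c (ij : 'I_n * 'I_n) : exists c,
    ij.1 != ij.2 -> P ij.1 ij.2 = c *: (p ij.1 *m q ij.2).
  case: ij => i j /=; have [->|ij] := eqVneq i j; first by exists 0.
  have [c e] := outer_of_sub _ _ _ _ _ _ (proj2 (hq j) i ij) (proj2 (hp i) j ij).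
  by exists c.
have [c hc] := fin_all_exists ex_c.
apply: (@basis_conj p q (fun i j => c (i, j)) _ _ _ _ i0 i1) => //.
- by move=> i j ij; apply: (hc (i, j)).
- move=> i j ij; apply: contra_neq (P_neq0 _ _ ij) => c0.
  by rewrite (hc (i, j) ij) c0 scale0r.
- by move=> i; case: (hp i).
by move=> j; case: (hq j).
Qed.

Lemma rank_one_dichotomy :
  (forall i j k, i != j -> i != k -> ((P i j)^T == (P i k)^T)%MS) /\
  (forall i j k, i != k -> j != k -> (P i k == P j k)%MS) \/
  (forall i j k, i != j -> i != k -> (P i j == P i k)%MS) /\
  (forall i j k, i != k -> j != k -> ((P i k)^T == (P j k)^T)%MS).
Proof. exact: (grid_dichotomy _ _ P P_neq0 P_rank P_row P_col P_corner). Qed.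

End RankOnePreserver.

Lemma rank_one_preserver (F : numFieldType) (n : nat)
    (f : {linear 'M[F]_n -> 'M[F]_n}) : (1 < n)%N ->
  (forall x, \tr x = 0 -> \tr (f x) = 0) ->
  (forall x, \tr x = 0 -> (\rank (f x) <= 1)%N = (\rank x <= 1)%N) ->
  (forall y, \tr y = 0 -> exists2 x, \tr x = 0 & f x = y) ->
  (forall x, \tr x = 0 -> f x = 0 -> x = 0) ->
  exists t (a : 'M[F]_n), a \in unitmx /\
    ((forall x, \tr x = 0 -> f x = t *: (a *m x *m invmx a)) \/
     (forall x, \tr x = 0 -> f x = t *: (a *m x^T *m invmx a))).
Proof.
move=> n1 f_tr f_rank f_surj f_inj.
pose i0 : 'I_n := Ordinal (ltnW n1); pose i1 : 'I_n := Ordinal n1.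
have i01 : i0 != i1 by [].
have [[colP rowP]|[rowP colP]] := rank_one_dichotomy _ _ f f_rank f_inj.
  have [t [a [au fa]]] := row_col_conj _ _ f f_tr f_rank f_surj f_inj _ _ i01 colP rowP.
  exists t, a; split=> //; left=> x trx.
  by rewrite scalemxAl -fa // mulmxK.
(* Transposition exchanges row and column spaces and so reduces to the first case. Transposing the
   conclusion back turns [a] into [invmx a^T]. *)
pose ft : {linear 'M[F]_n -> 'M[F]_n} := trmx \o f.
have [||||||t [a [au fa]]] := row_col_conj _ _ ft _ _ _ _ _ _ i01.
- by move=> x trx; rewrite /= mxtrace_tr f_tr.
- by move=> x trx; rewrite /= mxrank_tr f_rank.
- move=> y tr_y; have [|x trx fx] := f_surj y^T; first by rewrite mxtrace_tr.
  by exists x; rewrite //= fx trmxK.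
- move=> x trx /= /(congr1 trmx); rewrite trmxK trmx0; exact: f_inj.
- by move=> i j k ij ik /=; rewrite !trmxK; apply: rowP.
- by move=> i j k ik jk; apply: colP.
exists t, (invmx a^T); rewrite unitmx_inv unitmx_tr au; split=> //; right=> x trx.
have /(congr1 trmx) := fa x trx; rewrite /= trmx_mul trmxK linearZ /= trmx_mul.
by move/(congr1 (mulmx (invmx a^T))); rewrite mulKmx ?unitmx_tr // => ->;
  rewrite -scalemxAr mulmxA invmxK.
Qed.

(** * Maps of the special linear Lie algebra *)

Lemma linear_mx_surj (F : fieldType) (m n : nat)
    (f : {linear 'M[F]_(m, n) -> 'M[F]_(m, n)}) :
  (forall x, f x = 0 -> x = 0) -> forall y, exists x, f x = y.
Proof.
move=> f_inj y.
have Lu : lin_mx f \in unitmx.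
  rewrite -row_free_unit; apply: inj_row_free => v.
  rewrite mul_rV_lin => /eqP; rewrite mxvec_eq0 => /eqP /f_inj /eqP.
  by rewrite vec_mx_eq0 => /eqP.
exists (vec_mx (mxvec y *m invmx (lin_mx f))).
by rewrite -mx_rV_lin mulmxKV // mxvecK.
Qed.

(** [h] is diagonal with entries among 0, 1, -1. The eigenvalues of [ad h] are differences of these,
    hence roots of the polynomial with roots 0, 1, -1, 2, -2. *)
Lemma ad_coroot_eigenvalue (F : fieldType) (n : nat) (i j : 'I_n) (z : 'M[F]_n) (mu : F) :
  let h := delta_mx i i - delta_mx j j in
  z != 0 -> h *m z - z *m h = mu *: z ->
  mu * (mu ^+ 2 - 1) * (mu ^+ 2 - 4) = 0.
Proof.
move=> h /matrix0Pn [a [b zab]] /matrixP /(_ a b).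
pose d a : F := (a == i)%:R - (a == j)%:R.
have -> : h = diag_mx (\row_a d a).
  apply/matrixP=> k l; rewrite !mxE /d; have [->|kl] := eqVneq k l.
    by rewrite mulr1n !andbb.
  have kl_c c : (k == c) && (l == c) = false.
    by apply/andP => -[/eqP ek /eqP el]; rewrite ek el eqxx in kl.
  by rewrite mulr0n !kl_c subrr.
rewrite mul_diag_mx mul_mx_diag !mxE => e.
have -> : mu = d a - d b.
  by apply: (mulIf zab); rewrite -e; ring.
by rewrite /d; case: (a == i); case: (a == j); case: (b == i); case: (b == j) => /=; ring.
Qed.

Lemma conj_bracket (R : comUnitRingType) (n : nat) (a x y : 'M[R]_n) :
  a \in unitmx ->
  a *m (x *m y - y *m x) *m invmx a =
    (a *m x *m invmx a) *m (a *m y *m invmx a)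
    - (a *m y *m invmx a) *m (a *m x *m invmx a).
Proof. by move=> au; rewrite mulmxBr mulmxBl !mulmxA !mulmxKV. Qed.

Section SlMaps.
Variables (C : numClosedFieldType) (n : nat).

Lemma sl_trace0 (x : sl C n) : \tr (slval x) = 0.
Proof. by case: x => x /= /eqP. Qed.

Lemma sl_of_trace0 (x : 'M[C]_n) : \tr x = 0 -> exists X : sl C n, slval X = x.
Proof. by move=> trx; have h : x \in @tr0 C n by [rewrite inE trx]; exists (SL h). Qed.

Lemma slval_inj : injective (@slval C n).
Proof. exact: val_inj. Qed.

Lemma slvalZ (c : C) (x : sl C n) : slval (c *: x) = c *: slval x.
Proof. by []. Qed.

Lemma slvalD (x y : sl C n) : slval (x + y) = slval x + slval y.
Proof. by []. Qed.

Lemma slval0 : slval (0 : sl C n) = 0.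
Proof. by []. Qed.

Lemma sl_linear0 (f : sl C n -> sl C n) : linear f -> f 0 = 0.
Proof. by move=> lf; have := lf (-1) 0 0; rewrite scaler0 addr0 scaleN1r addNr. Qed.

Lemma sl_linearZ (f : sl C n -> sl C n) c x : linear f -> f (c *: x) = c *: f x.
Proof. by move=> lf; have := lf c x 0; rewrite !addr0 sl_linear0 // addr0. Qed.

Lemma sl_automorphism_of (F G : 'M[C]_n -> 'M[C]_n) :
  linear F -> (forall x, \tr x = 0 -> \tr (F x) = 0) ->
  (forall x, \tr x = 0 -> \tr (G x) = 0) -> cancel F G -> cancel G F ->
  (forall x y, F (x *m y - y *m x) = F x *m F y - F y *m F x) ->
  exists Phi, sl_automorphism Phi /\ forall x : sl C n, slval (Phi x) = F (slval x).
Proof.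
move=> lF trF trG FK GK Fbr.
have hF (x : sl C n) : F (slval x) \in @tr0 C n by rewrite inE trF ?sl_trace0.
have hG (x : sl C n) : G (slval x) \in @tr0 C n by rewrite inE trG ?sl_trace0.
exists (fun x => SL (hF x)); split=> //; split.
- by move=> c x y; apply: slval_inj; rewrite /= lF.
- by exists (fun x => SL (hG x)) => x; apply: slval_inj => /=.
by move=> x y; apply: slval_inj; rewrite /= Fbr.
Qed.

Lemma conj_sl_automorphism (a : 'M[C]_n) : a \in unitmx ->
  exists Phi, sl_automorphism Phi /\
    forall x : sl C n, slval (Phi x) = a *m slval x *m invmx a.
Proof.
move=> au; apply: (sl_automorphism_of (fun x => a *m x *m invmx a)
                                     (fun x => invmx a *m x *m a)).
- by move=> c x y; rewrite mulmxDr mulmxDl -scalemxAr -scalemxAl.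
- by move=> x trx; rewrite mxtrace_mulC mulmxA mulVmx // mul1mx.
- by move=> x trx; rewrite mxtrace_mulC mulmxA mulmxV // mul1mx.
- by move=> x; rewrite !mulmxA mulVmx // mul1mx mulmxKV.
- by move=> x; rewrite !mulmxA mulmxV // mul1mx mulmxK.
by move=> x y; exact: conj_bracket.
Qed.

(** Transposition reverses products and hence negates brackets; the sign repairs this. *)
Lemma contragredient_sl_automorphism (a : 'M[C]_n) : a \in unitmx ->
  exists Phi, sl_automorphism Phi /\
    forall x : sl C n, slval (Phi x) = - (a *m (slval x)^T *m invmx a).
Proof.
move=> au; apply: (sl_automorphism_of (fun x => - (a *m x^T *m invmx a))
                                     (fun x => - (invmx a *m x *m a)^T)).
- move=> c x y; rewrite linearP mulmxDr mulmxDl -scalemxAr -scalemxAl opprD.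
  by rewrite scalerN.
- move=> x trx; rewrite raddfN /= mxtrace_mulC mulmxA mulVmx // mul1mx.
  by rewrite mxtrace_tr trx oppr0.
- move=> x trx; rewrite raddfN /= mxtrace_tr mxtrace_mulC mulmxA mulmxV //.
  by rewrite mul1mx trx oppr0.
- move=> x; rewrite mulmxN mulNmx raddfN opprK !mulmxA mulVmx // mul1mx.
  by rewrite mulmxKV //= trmxK.
- move=> x; rewrite raddfN /= trmxK mulmxN mulNmx opprK !mulmxA mulmxV //.
  by rewrite mul1mx mulmxK.
move=> x y; rewrite raddfB /= !trmx_mul mulmxBr mulmxBl opprB.
by rewrite !mulNmx !mulmxN !opprK !mulmxA !mulmxKV.
Qed.

(** By [double_bracketP], rank at most one is a condition on brackets alone, which an automorphism
    and its inverse transport. *)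
Lemma sl_automorphism_rank (Phi : sl C n -> sl C n) (x : sl C n) :
  sl_automorphism Phi ->
  (\rank (slval (Phi x)) <= 1)%N = (\rank (slval x) <= 1)%N.
Proof.
case=> lPhi [Psi PhiK PsiK] Phibr.
have ext (z : sl C n) : (\rank (slval z) <= 1)%N <->
    forall y, exists c, slbr z (slbr z y) = c *: z.
  split=> [/(double_bracketP _ _ _ (sl_trace0 z)) h y|h].
    by have [c e] := h (slval y) (sl_trace0 y); exists c; apply: slval_inj.
  apply/(double_bracketP _ _ _ (sl_trace0 z)) => y0 /sl_of_trace0 [y <-].
  by have [c /(congr1 (@slval C n)) e] := h y; exists c.
apply/idP/idP => /ext h; apply/ext => y.
  have [c e] := h (Phi y); exists c; apply: (can_inj PhiK).
  by rewrite !Phibr e sl_linearZ.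
have [c e] := h (Psi y); exists c.
by rewrite -{1}(PsiK y) -!Phibr e sl_linearZ.
Qed.

(** [D] is extended by the identity on scalar matrices, which complement the traceless ones as [n]
    is nonzero in [C]. The extension preserves the trace. *)
Lemma sl_linear_extension (hn : (0 < n)%N) (D : sl C n -> sl C n) : linear D ->
  exists f : {linear 'M[C]_n -> 'M[C]_n},
    (forall x, \tr (f x) = \tr x) /\ forall x, f (slval x) = slval (D x).
Proof.
move=> lD; have n0 : n%:R != 0 :> C by rewrite pnatr_eq0 -lt0n.
have tr_scalar s : \tr (s%:M : 'M[C]_n) = s * n%:R by rewrite mxtrace_scalar mulr_natr.
have h (x : 'M[C]_n) : x - (\tr x / n%:R)%:M \in @tr0 C n.
  by rewrite inE raddfB /= tr_scalar divfK ?subrr.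
pose f x := slval (D (SL (h x))) + (\tr x / n%:R)%:M.
have lf : linear f.
  move=> c x y; rewrite /f.
  have -> : SL (h (c *: x + y)) = c *: SL (h x) + SL (h y).
    apply: slval_inj; rewrite slvalD slvalZ /= mxtraceD mxtraceZ mulrDl -mulrA.
    rewrite raddfD /= -scale_scalar_mx scalerBr opprD addrACA.
    by [].
  rewrite lD slvalD slvalZ mxtraceD mxtraceZ mulrDl -mulrA raddfD /=.
  by rewrite scalerDr scale_scalar_mx addrACA.
pose fL : {linear 'M[C]_n -> 'M[C]_n} := HB.pack f (GRing.isLinear.Build C _ _ _ f lf).
exists fL; split=> x; rewrite /= /f.
  by rewrite mxtraceD sl_trace0 add0r tr_scalar divfK.
have s0 : (\tr (slval x) / n%:R)%:M = 0 :> 'M[C]_n.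
  by rewrite sl_trace0 mul0r raddf0.
have -> : SL (h (slval x)) = x by apply: slval_inj; rewrite /= s0 subr0.
by rewrite s0 addr0.
Qed.

(* The eigenvalues of [ad h], [h = E i i - E j j], are among 0, 1, -1, 2, -2, and
   both [2 / t] and [2 * t] must be eigenvalues. *)
Lemma conj_scalar_sign (Phi : sl C n -> sl C n) (X : sl C n) (i j : 'I_n)
    (a : 'M[C]_n) (t : C) :
  let h := delta_mx i i - delta_mx j j in
  sl_automorphism Phi -> i != j -> a \in unitmx -> slval X = h ->
  slval (Phi X) = t *: (a *m h *m invmx a) -> t = 1 \/ t = -1.
Proof.
move=> h [lPhi [Psi PhiK PsiK] Phibr] ij au Xh PhiX.
have E0 : delta_mx i j != 0 :> 'M[C]_n.
  by apply/negP=> /eqP/matrixP/(_ i j)/eqP; rewrite !mxE !eqxx oner_eq0.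
have hE : h *m delta_mx i j - delta_mx i j *m h = 2 *: delta_mx i j.
  rewrite mulmxBl mulmxBr !mul_delta_mx !mul_delta_mx_0 1?eq_sym //.
  by rewrite subr0 sub0r opprK scaler_nat mulr2n.
have Phi_neq0 z : z != 0 -> Phi z != 0.
  by apply: contra_neq => z0; apply: (can_inj PhiK); rewrite z0 sl_linear0.
have [Y YE] : exists Y : sl C n, slval Y = delta_mx i j.
  by apply: sl_of_trace0; rewrite mxtrace_delta (negPf ij).
have Y0 : Y != 0 by apply: contra_neq E0 => Y0; rewrite -YE Y0.
pose z := invmx a *m slval (Phi Y) *m a.
have z0 : z != 0.
  apply: contra_neq (Phi_neq0 _ Y0) => z0; apply: slval_inj; rewrite slval0.
  by rewrite -[LHS](mulmxK au) -[_ *m a](mulKVmx au) [invmx a *m (_ *m a)]mulmxA -/z z0 mulmx0 mul0mx.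
(* Apply [Phi] to [[h, E_ij] = 2 E_ij] and conjugate back by [a]: [z] is an eigenvector of [ad h]
   for [2 / t]. *)
have zE : t *: (h *m z - z *m h) = 2 *: z.
  have XY : slbr X Y = 2 *: Y by apply: slval_inj; rewrite slvalZ /= Xh YE hE.
  have := congr1 (@slval C n) (Phibr X Y).
  rewrite XY sl_linearZ // slvalZ /= PhiX; set W := slval (Phi Y) => eW.
  have K u : invmx a *m (a *m u *m invmx a) *m a = u.
    by rewrite !mulmxA mulVmx // mul1mx mulmxKV.
  have WE : W = a *m z *m invmx a.
    by rewrite /z -/W !mulmxA mulmxV // mul1mx mulmxK.
  rewrite -[LHS]K -[RHS]K -!scalemxAr -!scalemxAl; congr (invmx a *m _ *m a).
  by rewrite -WE eW WE -scalemxAl -scalemxAr -scalerBr conj_bracket.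
have t0 : t != 0.
  apply: contra_neq z0 => t0; move: zE; rewrite t0 scale0r => /esym/eqP.
  by rewrite scaler_eq0 pnatr_eq0 => /eqP.
have P1 : (2 / t) * ((2 / t) ^+ 2 - 1) * ((2 / t) ^+ 2 - 4) = 0.
  apply: (ad_coroot_eigenvalue _ _ i j z) => //.
  by rewrite [2 / t]mulrC -scalerA -zE scalerA mulVf ?scale1r.
(* Conversely [a E_ij a^-1] is an eigenvector of [ad (Phi X)] for [2 * t], and its preimage under
   [Phi] is one of [ad h]. *)
have [Y' Y'E] : exists Y : sl C n, slval Y = a *m delta_mx i j *m invmx a.
  apply: sl_of_trace0; rewrite mxtrace_mulC mulmxA mulVmx // mul1mx.
  by rewrite mxtrace_delta (negPf ij).
have P2 : (2 * t) * ((2 * t) ^+ 2 - 1) * ((2 * t) ^+ 2 - 4) = 0.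
  apply: (ad_coroot_eigenvalue _ _ i j (slval (Psi Y'))).
    apply: contra_neq E0 => Psi0.
    have Y'0 : Y' = 0.
      by rewrite -(PsiK Y') (slval_inj (Psi Y') 0 Psi0) sl_linear0.
    have : a *m delta_mx i j *m invmx a = 0 by rewrite -Y'E Y'0.
    by move/(congr1 (fun w => invmx a *m w *m a));
      rewrite !mulmxA mulVmx // mul1mx mulmxKV // mulmx0 mul0mx.
  have e : slbr (Phi X) Y' = (2 * t) *: Y'.
    apply: slval_inj; rewrite slvalZ /= PhiX Y'E -scalemxAl -scalemxAr -scalerBr.
    by rewrite -conj_bracket // hE -scalemxAr -scalemxAl scalerA mulrC.
  have {}e : slbr X (Psi Y') = (2 * t) *: Psi Y'.
    by apply: (can_inj PhiK); rewrite Phibr PsiK e sl_linearZ // PsiK.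
  by have := congr1 (@slval C n) e; rewrite /= Xh.
(* If [t^2] is not 1, then [P2] forces [4 t^2 = 1]. Then [(2 / t)^2 = 16], which [P1] excludes. *)
have [t1|t1] := eqVneq (t ^+ 2) 1.
  by have := sqrf_eq1 t; rewrite t1 eqxx => /esym/orP[]/eqP; [left|right].
have t4 : 4 * t ^+ 2 = 1.
  have : t * (4 * t ^+ 2 - 1) * (8 * (t ^+ 2 - 1)) = 0 by rewrite -P2; ring.
  move/eqP; rewrite !mulf_eq0 (negPf t0) pnatr_eq0 !subr_eq0 (negPf t1) !orbF.
  by move/eqP.
have mu16 : (2 / t) ^+ 2 = 16.
  apply: (mulIf (_ : t ^+ 2 != 0)); rewrite ?sqrf_eq0 //.
  by rewrite -exprMn divfK // (_ : 16 = 4 * 4) -?mulrA ?t4; ring.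
move/eqP: P1; rewrite mu16 !mulf_eq0 invr_eq0 (negPf t0) pnatr_eq0 /=.
have -> : 16 - 1 = 15 :> C by ring.
have -> : 16 - 4 = 12 :> C by ring.
by rewrite !pnatr_eq0.
Qed.

End SlMaps.

(** * Local automorphisms of the trace-zero matrices *)

Theorem theorem2p3 (C : numClosedFieldType) (n : nat) (hn : (2 <= n)%N)
    (D : sl C n -> sl C n) :
  sl_local_automorphism D <->
  exists (a : 'M[C]_n) (eps : C),
    [/\ a \in unitmx, eps = 1 \/ eps = -1 &
      (forall x : sl C n, slval (D x) = eps *: (a *m slval x *m invmx a)) \/
      (forall x : sl C n, slval (D x) = eps *: (a *m (slval x)^T *m invmx a))].
Proof.
have n0 : (0 < n)%N := ltnW hn.
split=> [[lD locD]|[a [eps [au eps1 Da]]]].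
  have D_inj x : D x = 0 -> x = 0.
    have [Phi [[lPhi [Psi PhiK _] _] <-]] := locD x => e.
    by apply: (can_inj PhiK); rewrite e sl_linear0.
  have [f [f_tr fD]] := sl_linear_extension _ _ n0 D lD.
  have f_inj x : f x = 0 -> x = 0.
    move=> fx0; have /sl_of_trace0 [X XE] : \tr x = 0 by rewrite -f_tr fx0 mxtrace0.
    rewrite -XE (D_inj X) //; apply: slval_inj.
    by rewrite -fD XE fx0.
  have [||||t [a [au ta]]] := rank_one_preserver _ _ f hn.
  - by move=> x trx; rewrite f_tr.
  - move=> x /sl_of_trace0 [X <-]; rewrite fD; have [Phi [autPhi <-]] := locD X.
    exact: sl_automorphism_rank.
  - move=> y tr_y; have [x fx] := linear_mx_surj _ _ _ f f_inj y.
    by exists x; rewrite // -f_tr fx.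
  - by move=> x _; apply: f_inj.
  exists a, t; split=> //; last first.
    by case: ta => fa; [left|right] => x; rewrite -fD fa // sl_trace0.
  (* The scalar is tested on a diagonal matrix, which equals its transpose, so both forms of [f] are
     treated at once. *)
  pose i : 'I_n := Ordinal n0; pose j : 'I_n := Ordinal hn.
  have trh : \tr (delta_mx i i - delta_mx j j : 'M[C]_n) = 0.
    by rewrite raddfB /= !mxtrace_delta !eqxx subrr.
  have [X XE] := sl_of_trace0 _ _ _ trh; have [Phi [autPhi PhiX]] := locD X.
  apply: (conj_scalar_sign _ _ Phi X i j a t) => //.
  rewrite PhiX -fD XE; case: ta => -> //.
  by rewrite raddfB /= !trmx_delta.
split=> [c x y|x].
  apply: slval_inj; rewrite slvalD slvalZ; case: Da => Da; rewrite !Da.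
    rewrite slvalD slvalZ mulmxDr mulmxDl -scalemxAr -scalemxAl scalerDr !scalerA.
    by rewrite [eps * c]mulrC.
  rewrite slvalD slvalZ linearP mulmxDr mulmxDl -scalemxAr -scalemxAl scalerDr.
  by rewrite !scalerA [eps * c]mulrC.
(* Since [x^T = S^-1 x S] with [S] depending on [x], the map [a x^T a^-1] agrees at [x] with
   conjugation by [a S^-1]. Likewise [- a x a^-1] agrees there with the contragredient map of
   [a S]. *)
have [S Su xS] := trmx_similar _ _ (slval x).
have xT : (slval x)^T = invmx S *m slval x *m S.
  by rewrite -mulmxA xS mulKmx.
have inv_mul (u v : 'M[C]_n) : u \in unitmx -> v \in unitmx ->
    invmx (u *m v) = invmx v *m invmx u.
  move=> uu vu; have uvu : u *m v \in unitmx by rewrite unitmx_mul uu.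
  by apply: (can_inj (mulKmx uvu)); rewrite mulmxV // !mulmxA mulmxK // mulmxV.
case: eps1 Da => -> [Da|Da].
- have [Phi [autPhi PhiE]] := conj_sl_automorphism _ _ a au.
  by exists Phi; split=> //; apply: slval_inj; rewrite PhiE Da scale1r.
- have bu : a *m invmx S \in unitmx by rewrite unitmx_mul au unitmx_inv.
  have [Phi [autPhi PhiE]] := conj_sl_automorphism _ _ _ bu.
  exists Phi; split=> //; apply: slval_inj; rewrite PhiE Da scale1r xT.
  by rewrite inv_mul ?unitmx_inv // invmxK !mulmxA.
- have bu : a *m S \in unitmx by rewrite unitmx_mul au.
  have [Phi [autPhi PhiE]] := contragredient_sl_automorphism _ _ _ bu.
  exists Phi; split=> //; apply: slval_inj; rewrite PhiE Da scaleN1r xT.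
  by rewrite inv_mul // !mulmxA !mulmxK.
have [Phi [autPhi PhiE]] := contragredient_sl_automorphism _ _ a au.
by exists Phi; split=> //; apply: slval_inj; rewrite PhiE Da scaleN1r.
Qed.
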